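(* Let $e$ be an edge of a finite graph $G$ which is not a loop. Then there is a short exact sequence of degree preserving chain maps \[0\to C^{i-1}(G/e)\xrightarrow{\alpha}C^i(G)\xrightarrow{\beta}C^i(G-e)\to 0,\] where $\alpha$ maps each summand $C^{s}(G/e)$ isomorphically onto $C^{s\cup\{e\}}(G)$ via the identification induced by contracting $e$ (the graphs $[G:s\cup\{e\}]$ and $[G/e:s]$ being homotopy equivalent), and $\beta$ is zero on the summands $C^s(G)$ with $e\in s$ and is the identity $C^s(G)=C^s(G-e)$ on summands with $e\notin s$. Consequently there is a long exact sequence \[0\to H^0(G)\xrightarrow{\beta^*}H^0(G-e)\xrightarrow{\gamma^*}H^0(G/e)\xrightarrow{\alpha^*}H^1(G)\xrightarrow{\beta^*}H^1(G-e)\xrightarrow{\gamma^*}H^1(G/e)\xrightarrow{\alpha^*}\cdots\]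
   Context: Graphs are finite, loops and multiple edges allowed; $G-e$ is deletion and $G/e$ contraction of $e$, and $E(G-e)$, $E(G/e)$ are identified with $E(G)\setminus\{e\}$. $A=\mathbb{Z}[x]/(x^2)$, $B=\mathbb{Z}[y]/(y^2)$, bigraded with $\deg x=(1,0)$, $\deg y=(0,1)$. For a graph $G$ with ordered edges $e_1,\dots,e_n$ and $s\subseteq E(G)$, $[G:s]$ is the spanning subgraph with edge set $s$, with $b_0(s)$ components and first Betti number $b_1(s)$; $C^s(G)=A^{\otimes b_0(s)}\otimes B^{\otimes b_1(s)}$ (one $A$ factor per component), $C^i(G)=\bigoplus_{|s|=i}C^s(G)$. For $e_j\notin s$, the per-edge map $d_{s,j}:C^s(G)\to C^{s\cup\{e_j\}}(G)$ multiplies the $A$ factors of the two components joined by $e_j$ if they are distinct (identity elsewhere), and otherwise is the identity on the $A$ factors and $b\mapsto b\otimes 1$ on $B^{\otimes b_1(s)}$. The differential is $d^i=\sum_{|s|=i}\sum_{e_j\notin s}(-1)^{|\{k<j:e_k\in s\}|}d_{s,j}$, and $H^i(G)$ is its cohomology (independent of the edge ordering up to isomorphism).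
   Formalization: For an arbitrary edge ordering, α on C^s(G/e) is the contraction identification times (-1)^{#edges of s after e}, since the unsigned one is a chain map in general only when e is last (sign 1); the parenthetical homotopy equivalence is not stated. *)

(* Defs.v *)
From HB Require Import structures.
From mathcomp Require Import all_boot all_order all_algebra.
From mathcomp Require Import boolp.

Set Implicit Arguments.
Unset Strict Implicit.
Unset Printing Implicit Defensive.

Import GRing.Theory.
Local Open Scope ring_scope.

(* Finite multigraphs; loops and parallel edges are allowed.  The edges are a
   set of labels in 'I_n, ordered as natural numbers, so that E(G - e) and
   E(G / e) are literally E(G) :\ e, with the induced order.  The values of
   [ends] outside [edges] play no role, and neither does the order of the two
   ends of an edge. *)
Record mgraph := MGraph {
  vert : finType;
  nlab : nat;
  edges : {set 'I_nlab};
  ends : 'I_nlab -> vert * vert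
}.

Definition is_loop (G : mgraph) (e : 'I_(nlab G)) : bool :=
  (ends e).1 == (ends e).2.

Definition delete (G : mgraph) (e : 'I_(nlab G)) : mgraph :=
  MGraph (edges G :\ e) (@ends G).

(* The vertices of G / e are the classes of the equivalence relation which
   identifies the two ends of e. *)
Definition contr_class (G : mgraph) (e : 'I_(nlab G)) (v : vert G)
    : {set vert G} :=
  if v \in [set (ends e).1; (ends e).2] then [set (ends e).1; (ends e).2]
  else [set v].

Definition contr_vert (G : mgraph) (e : 'I_(nlab G)) : finType :=
  {B : {set vert G} | B \in codom (contr_class e)}.

Definition contr_proj (G : mgraph) (e : 'I_(nlab G)) (v : vert G)
    : contr_vert e :=
  exist _ (contr_class e v) (codom_f (contr_class e) v).

Definition contract (G : mgraph) (e : 'I_(nlab G)) : mgraph :=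
  @MGraph (contr_vert e) (nlab G) (edges G :\ e)
    (fun f => (contr_proj e (ends f).1, contr_proj e (ends f).2)).

Section SpanningSubgraph.
Variable G : mgraph.
Implicit Types s : {set 'I_(nlab G)}.

Definition adj s : rel (vert G) := fun u v =>
  [exists f in s, (ends f == (u, v)) || (ends f == (v, u))].

Definition components s : {set {set vert G}} :=
  equivalence_partition (connect (adj s)) [set: vert G].

Definition comp s : finType := {c : {set vert G} | c \in components s}.

(* The cellular boundary map Q^s -> Q^V of [G : s], acting on row vectors; a
   loop is sent to 0. *)
Definition boundary s : 'M[rat]_(#|s|, #|vert G|) :=
  \matrix_(i, j) ((enum_val j == (ends (enum_val i)).2)%:R
                - (enum_val j == (ends (enum_val i)).1)%:R).

Definition betti1 s : nat := \rank (kermx (boundary s)).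

(* A = Z[x]/(x^2) and B = Z[y]/(y^2) are free over Z on the powers of x and of
   y with exponents in 'I_2.  Hence C^s = A^{(x) b_0(s)} (x) B^{(x) b_1(s)} is
   the free abelian group on the pure tensors of such powers; the pair (a, b)
   stands for the tensor with factor x^(a c) at the component c and factor
   y^(b k) at the k-th copy of B. *)
Definition basis s : finType :=
  ({ffun comp s -> 'I_2} * {ffun 'I_(betti1 s) -> 'I_2})%type.

Definition Csub s : zmodType := {ffun basis s -> int}.

(* (a', b') is the image of (a, b) under C^s -> C^(s U {j}).  Every component
   c' of the larger graph gets the product of the powers of x carried by the
   components of [G : s] inside c': there are two of them if j joins distinct
   components and c' contains j, and only one, namely c' itself, otherwise.  A
   product x * x has no image, the exponent 2 not being in 'I_2.  The first
   b_1(s) copies of B are preserved, and the additional copy, which exists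
   exactly when j does not join distinct components, gets 1 = y^0. *)
Definition edge_rel s s' (v : basis s) (v' : basis s') : bool :=
  [forall c' : comp s',
     v'.1 c' == (\sum_(c : comp s | val c \subset val c') v.1 c)%N :> nat]
  && [forall k' : 'I_(betti1 s'),
     v'.2 k' == (if insub (val k') is Some k then v.2 k else ord0)].

Definition edge_map s (j : 'I_(nlab G)) (y : Csub s) : Csub (j |: s) :=
  [ffun v' => \sum_(v | edge_rel v v') y v].

Section Cochains.
Variable i : nat.

Definition state : finType :=
  {t : {s : {set 'I_(nlab G)} & basis s}
     | (tag t \subset edges G) && (#|tag t| == i)}.

(* The direct sum of the C^s over the sets s of i edges of G. *)
Definition cochain : zmodType := {ffun state -> int}.

(* The inclusion of the summand C^s and the projection onto it, for s a set of
   i edges of G; both vanish for any other s. *)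
Definition incl s (y : Csub s) : cochain :=
  [ffun t => \sum_(v | val t == Tagged basis v) y v].

Definition proj s (x : cochain) : Csub s :=
  [ffun v => \sum_(t | val t == Tagged basis v) x t].

Definition homogeneous (p q : nat) (x : cochain) : Prop :=
  forall t : state, x t != 0 ->
    (\sum_c (tagged (val t)).1 c = p)%N /\ (\sum_k (tagged (val t)).2 k = q)%N.

End Cochains.

Definition edge_sign s (j : 'I_(nlab G)) : int :=
  (-1) ^+ #|[set k in s | (k < j)%N]|.

Definition diff i (x : cochain i) : cochain i.+1 :=
  \sum_(s : {set 'I_(nlab G)} | (s \subset edges G) && (#|s| == i))
    \sum_(j in edges G :\: s)
      incl i.+1 (edge_map j (proj s x)) *~ edge_sign s j.

Lemma edge_map_is_zmod_morphism s j : zmod_morphism (@edge_map s j).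
Proof.
move=> x y; apply/ffunP=> v; rewrite !ffunE -sumrB.
by apply: eq_bigr => w _; rewrite !ffunE.
Qed.

Lemma incl_is_zmod_morphism i s : zmod_morphism (@incl i s).
Proof.
move=> x y; apply/ffunP=> v; rewrite !ffunE -sumrB.
by apply: eq_bigr => w _; rewrite !ffunE.
Qed.

Lemma proj_is_zmod_morphism i s : zmod_morphism (@proj i s).
Proof.
move=> x y; apply/ffunP=> v; rewrite !ffunE -sumrB.
by apply: eq_bigr => w _; rewrite !ffunE.
Qed.

HB.instance Definition _ s j := GRing.isZmodMorphism.Build
  (Csub s) (Csub (j |: s)) (@edge_map s j) (@edge_map_is_zmod_morphism s j).
HB.instance Definition _ i s := GRing.isZmodMorphism.Build
  (Csub s) (cochain i) (@incl i s) (@incl_is_zmod_morphism i s).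
HB.instance Definition _ i s := GRing.isZmodMorphism.Build
  (cochain i) (Csub s) (@proj i s) (@proj_is_zmod_morphism i s).

Lemma diff_is_zmod_morphism i : zmod_morphism (@diff i).
Proof.
move=> x y; rewrite /diff -sumrB; apply: eq_bigr => s _.
rewrite -sumrB; apply: eq_bigr => j _.
by rewrite !raddfB /= mulrzBl.
Qed.

HB.instance Definition _ i := GRing.isZmodMorphism.Build
  (cochain i) (cochain i.+1) (@diff i) (@diff_is_zmod_morphism i).

Section Cohomology.
Variable i : nat.

Definition is_cocycle : {pred cochain i} := [pred x | diff x == 0].

Lemma is_cocycle_zmod_closed : zmod_closed is_cocycle.
Proof.
split=> [|x y]; rewrite !inE ?raddf0 // => /eqP dx /eqP dy.
by rewrite raddfB /= dx dy subrr.
Qed.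

HB.instance Definition _ := GRing.isZmodClosed.Build
  (cochain i) is_cocycle is_cocycle_zmod_closed.

Record cocycle := Cocycle {
  cocycle_val :> cochain i;
  cocycleP : cocycle_val \in is_cocycle
}.

HB.instance Definition _ := [isSub for cocycle_val].
HB.instance Definition _ := [Choice of cocycle by <:].
HB.instance Definition _ := [SubChoice_isSubZmodule of cocycle by <:].

End Cohomology.

(* As C^(-1) = 0, the only coboundary in degree 0 is 0. *)
Definition is_coboundary i : {pred cocycle i} :=
  match i return {pred cocycle i} with
  | 0%N => [pred z | z == 0]
  | i'.+1 => [pred z : cocycle i'.+1 |
                `[< exists y : cochain i', diff y = cocycle_val z >]]
  end.

Lemma is_coboundary_zmod_closed i : zmod_closed (@is_coboundary i).
Proof.
case: i => [|i]; split=> [|x y]; rewrite !inE //.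
- by move=> /eqP-> /eqP->; rewrite subrr.
- by apply/asboolP; exists 0; rewrite raddf0.
move=> /asboolP[a da] /asboolP[b db]; apply/asboolP.
by exists (a - b); rewrite raddfB /= da db.
Qed.

HB.instance Definition _ i := GRing.isZmodClosed.Build
  (cocycle i) (@is_coboundary i) (@is_coboundary_zmod_closed i).

Definition cohomology i : zmodType := {ideal_quot (@is_coboundary i)}.

Definition coh_class i (z : cocycle i) : cohomology i :=
  \pi_(cohomology i)%qT z.

End SpanningSubgraph.

(* The identification C^s(G / e) = C^(s U {e})(G): contracting e maps the
   components of [G : s U {e}] bijectively onto those of [G / e : s], and the
   copies of B correspond by position. *)
Definition contr_match (G : mgraph) (e : 'I_(nlab G)) (s : {set 'I_(nlab G)})
    (w : basis (G := contract e) s) (v : basis (e |: s)) : bool :=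
  [forall c : comp (e |: s), forall c' : comp (G := contract e) s,
     (val c' == contr_proj e @: val c) ==> (w.1 c' == v.1 c)]
  && [forall k : 'I_(betti1 (e |: s)),
      forall k' : 'I_(betti1 (G := contract e) s),
     (k' == k :> nat) ==> (w.2 k' == v.2 k)].

Definition contr_id (G : mgraph) (e : 'I_(nlab G)) (s : {set 'I_(nlab G)})
    (y : Csub (G := contract e) s) : Csub (e |: s) :=
  [ffun v => \sum_(w | @contr_match G e s w v) y w].

(* For j != e, the signs of j with respect to s U {e} in G and to s in G / e
   differ exactly when e < j, so that contr_id commutes with the differentials
   only up to this factor, which is 1 when e is the last edge. *)
Definition contr_sign n (e : 'I_n) (s : {set 'I_n}) : int :=
  (-1) ^+ #|[set k in s | (e < k)%N]|.

Lemma contr_sign_last n (e : 'I_n) (s : {set 'I_n}) :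
  (forall k, k \in s -> (k <= e)%N) -> contr_sign e s = 1.
Proof.
move=> le_e; rewrite /contr_sign (_ : [set k in s | _] = set0) ?cards0 //.
apply/setP=> k; rewrite !inE; apply/negP=> /andP[/le_e].
by rewrite leqNgt => /negP.
Qed.

Definition exact_at (U V W : zmodType) (f : U -> V) (g : V -> W) : Prop :=
  forall v, g v = 0 <-> exists u, f u = v.

(* Main.v *)
(* The states, that is the pairs of a set s of edges and a tensor of monomials
   in C^s, are a Z-basis of the cochains.  The states of G whose edge set avoids
   e are those of G - e, and the ones whose edge set contains e correspond to
   those of G / e: contraction matches the components of [G : s U {e}] with
   those of [G / e : s], and the cycle rank is unchanged because the kernel of
   the projection Q^V(G) -> Q^V(G/e) is spanned by the boundary of e.  So alpha
   is a signed inclusion of basis elements and beta a projection onto the others,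
   and being chain maps amounts to identities between matrix coefficients of the
   differentials.  The long exact sequence is the zigzag lemma, which only
   requires d o d = 0: the maps on tensors commute, since the exponents of x add
   up and the copies of B are appended in a fixed order, and the signs cancel. *)

From HB Require Import structures.
Require Import Defs.
From mathcomp Require Import all_boot all_order all_algebra.
From mathcomp Require Import boolp zify.

Set Implicit Arguments.
Unset Strict Implicit.
Unset Printing Implicit Defensive.

Import GRing.Theory.
Local Open Scope ring_scope.

(** * Components of spanning subgraphs and how they grow with the edge set *)

Section Components.
Notation comp := Defs.comp.
Variable G : mgraph.
Implicit Types (s : {set 'I_(nlab G)}) (u v : vert G).

Lemma adj_sym s : symmetric (adj s).
Proof. by move=> u v; apply: eq_existsb => f; rewrite orbC. Qed.

Lemma connect_adj_sym s : connect_sym (adj s).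
Proof. exact/sym_connect_sym/adj_sym. Qed.

Lemma connect_adjS s s' u v :
  s \subset s' -> connect (adj s) u v -> connect (adj s') u v.
Proof.
move=> ss'; apply: connect_sub => {}u {}v /exists_inP[f fs fuv].
by apply/connect1/exists_inP; exists f; rewrite ?(subsetP ss').
Qed.

Lemma component_in s v : [set u | connect (adj s) v u] \in components s.
Proof. by apply/imsetP; exists v => //; apply/setP=> u; rewrite !inE. Qed.

Definition component s v : comp s :=
  exist _ [set u | connect (adj s) v u] (component_in s v).

Lemma mem_component s u v : (u \in val (component s v)) = connect (adj s) v u.
Proof. by rewrite inE. Qed.

(** The boolean equality allows [xchoose] to pick a representative vertex of [c]. *)
Lemma componentP s (c : comp s) : exists v, c == component s v.
Proof.
case: c => c cs; have /imsetP[v _ cE] := cs.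
by exists v; apply/eqP/val_inj; rewrite /= cE; apply/setP=> u; rewrite !inE.
Qed.

Lemma mem_comp s (c : comp s) v : (v \in val c) = (c == component s v).
Proof.
apply/idP/eqP => [|->]; last by rewrite mem_component.
have [u /eqP->] := componentP c; rewrite mem_component => uv.
apply: val_inj; apply/setP=> w; rewrite !inE.
exact: same_connect (connect_adj_sym s) _ _ uv w.
Qed.

(** Goes through a chosen vertex of [c]; when [s \subset s'], the result is the component that
    contains all of [c]. *)
Definition comp_up s s' (c : comp s) : comp s' :=
  component s' (xchoose (componentP c)).

(** Turns the inclusion that indexes the sums in [edge_rel] into the fibre of a function, so that
    such sums can be regrouped. *)
Lemma comp_upP s s' (c : comp s) (c' : comp s') :
  s \subset s' -> (val c \subset val c') = (comp_up s' c == c').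
Proof.
move=> ss'; rewrite /comp_up; set v := xchoose _.
have cE : c = component s v := eqP (xchooseP (componentP c)).
rewrite eq_sym -mem_comp; apply/subsetP/idP => [|vc' u].
  by apply; rewrite cE mem_component.
rewrite cE mem_component => vu.
by move: vc'; rewrite !mem_comp => /eqP->; rewrite -mem_comp mem_component
  (connect_adjS ss').
Qed.

Lemma comp_upK s s' s'' (c : comp s) :
  s \subset s' -> s' \subset s'' -> comp_up s'' (comp_up s' c) = comp_up s'' c.
Proof.
move=> ss' s's''; apply/esym/eqP; rewrite -comp_upP ?(subset_trans ss') //.
have := eqxx (comp_up s' c); rewrite -comp_upP // => /subset_trans; apply.
by rewrite comp_upP.
Qed.

End Components.

(** * First Betti numbers through the rank of the boundary matrix *)

Section Betti.
Variable G : mgraph.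
Implicit Types (s : {set 'I_(nlab G)}) (j : 'I_(nlab G)).

Definition edge_row j : 'rV[rat]_#|vert G| :=
  \row_k ((enum_val k == (ends j).2)%:R - (enum_val k == (ends j).1)%:R).

Lemma row_boundary s i : row i (boundary s) = edge_row (enum_val i).
Proof. by apply/rowP=> k; rewrite !mxE. Qed.

Lemma edge_row_boundary s j : j \in s -> (edge_row j <= boundary s)%MS.
Proof.
move=> js; apply: (eq_row_sub (enum_rank_in js j)).
by rewrite row_boundary enum_rankK_in.
Qed.

Lemma boundary_subP s m (A : 'M_(m, #|vert G|)) :
  (forall j, j \in s -> (edge_row j <= A)%MS) -> (boundary s <= A)%MS.
Proof.
by move=> sA; apply/row_subP=> i; rewrite row_boundary sA ?enum_valP.
Qed.

Lemma betti1E s : betti1 s = (#|s| - \rank (boundary s))%N.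
Proof. exact: mxrank_ker. Qed.

(** Each new edge contributes one row, so the rank of the boundary grows by at most the number of
    new edges. *)
Lemma betti1S s s' : s \subset s' -> (betti1 s <= betti1 s')%N.
Proof.
move=> ss'; rewrite !betti1E.
suff le_rk : (\rank (boundary s') <= \rank (boundary s) + #|s' :\: s|)%N.
  have := cardsID s s'; rewrite (setIidPr ss').
  by have := rank_leq_row (boundary s); lia.
rewrite (@leq_trans (\rank (boundary s + boundary (s' :\: s))%MS)) //.
  apply/mxrankS/boundary_subP=> j js'; have [js|js] := boolP (j \in s).
    by rewrite (submx_trans (edge_row_boundary js)) ?addsmxSl.
  by rewrite (submx_trans (@edge_row_boundary (s' :\: s) j _)) ?addsmxSr // inE js.
by rewrite (leq_trans (mxrank_adds_leqif _ _)) // leq_add2l rank_leq_row.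
Qed.

End Betti.

(** * Composition and factorization of the per-edge maps on monomials *)

Section EdgeRel.
Variable G : mgraph.
Notation comp := Defs.comp.
Implicit Types s : {set 'I_(nlab G)}.

Lemma edge_relP s s' (v : basis s) (v' : basis s') :
  reflect ((forall c' : comp s',
              v'.1 c' = (\sum_(c : comp s | val c \subset val c') v.1 c)%N :> nat)
           /\ (forall k', v'.2 k' =
                 if insub (val k') is Some k then v.2 k else ord0))
    (edge_rel v v').
Proof.
apply: (iffP andP) => [[/forallP av /forallP bv] | [av bv]]; split.
- by move=> c'; apply/eqP.
- by move=> k'; apply/eqP.
- by apply/forallP=> c'; apply/eqP.
- by apply/forallP=> k'; apply/eqP.
Qed.

(** Makes [edge_rel] the graph of a partial map on monomials, undefined when a product of two
    factors x arises. *)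
Lemma edge_rel_inj s s' (v : basis s) (v1 v2 : basis s') :
  edge_rel v v1 -> edge_rel v v2 -> v1 = v2.
Proof.
case: v1 v2 => [a1 b1] [a2 b2] /edge_relP[/= av1 bv1] /edge_relP[/= av2 bv2].
congr (_, _); apply/ffunP=> k; last by rewrite bv1 bv2.
by apply: val_inj; rewrite /= av1 av2.
Qed.

(** Each component of [s] inside [c''] lies in exactly one component of [s'], so the sum splits
    along the fibres of [comp_up]. *)
Lemma sum_comp_up s s' s'' (a : comp s -> nat) (a' : comp s' -> nat)
    (c'' : comp s'') :
    s \subset s' -> s' \subset s'' ->
    (forall c' : comp s', val c' \subset val c'' ->
       a' c' = \sum_(c : comp s | val c \subset val c') a c)%N ->
  (\sum_(c' : comp s' | val c' \subset val c'') a' c'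
     = \sum_(c : comp s | val c \subset val c'') a c)%N.
Proof.
move=> ss' s's'' aE; have ss'' := subset_trans ss' s's''.
rewrite [RHS](partition_big (@comp_up _ s s') (fun c' => val c' \subset val c'')).
  apply: eq_bigr => c' c'c''; rewrite aE //.
  apply: eq_bigl => c; rewrite !comp_upP // -(comp_upK c ss' s's'').
  case: eqP => [-> | _]; rewrite ?andbF // andbT.
  by rewrite comp_upP // in c'c''; rewrite c'c''.
by move=> c; rewrite !comp_upP // comp_upK.
Qed.

Lemma edge_rel_trans s s' s'' (v : basis s) (v' : basis s') (v'' : basis s'') :
    s \subset s' -> s' \subset s'' ->
  edge_rel v v' -> edge_rel v' v'' -> edge_rel v v''.
Proof.
move=> ss' s's'' /edge_relP[av bv] /edge_relP[av' bv']; apply/edge_relP; split.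
  by move=> c''; rewrite av' (@sum_comp_up s _ _ (fun c => v.1 c)).
(* A position beyond the first Betti number of [s'] is also beyond that of [s], so both sides take
   the default exponent 0. *)
move=> k''; rewrite bv'; case: insubP => [k' _ <- | nk'] //.
case: insubP => // k kb _; case/negP: nk'.
exact: leq_trans kb (betti1S ss').
Qed.

(* The exponents of v' are partial sums of those of v'', hence at most 1. *)
Lemma edge_rel_factor s s' s'' (v : basis s) (v'' : basis s'') :
    s \subset s' -> s' \subset s'' -> edge_rel v v'' ->
  exists2 v' : basis s', edge_rel v v' & edge_rel v' v''.
Proof.
move=> ss' s's'' /edge_relP[av bv].
pose a' (c' : comp s') := (\sum_(c : comp s | val c \subset val c') v.1 c)%N.
have a'E (c'' : comp s'') : (\sum_(c' : comp s' | val c' \subset val c'') a' c')%N = v''.1 c''.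
  by rewrite av; apply: sum_comp_up.
have a'lt (c' : comp s') : (a' c' < 2)%N.
  have c'c'' : val c' \subset val (comp_up s'' c') by rewrite comp_upP.
  have := ltn_ord (v''.1 (comp_up s'' c')); apply: leq_trans.
  by rewrite ltnS -a'E (bigD1 c') //= leq_addr.
exists ([ffun c' => Ordinal (a'lt c')],
        [ffun k' : 'I_(betti1 s') => if insub (val k') is Some k then v.2 k else ord0]).
  by apply/edge_relP; split=> k; rewrite ffunE.
apply/edge_relP; split=> [c'' | k''].
  by rewrite -a'E; apply: eq_bigr => c' _; rewrite ffunE.
rewrite bv; case: (insubP _ (val k'')) => [k kb kE | nk].
  case: insubP => [k' _ k'E | /negP[]].
    by rewrite ffunE k'E -kE valK.
  exact: leq_trans kb (betti1S ss').
case: insubP => [k' _ k'E | //]; rewrite ffunE k'E.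
by case: insubP nk => // k ->.
Qed.

(** The count is the matrix coefficient of the composite through [s'], and its value does not
    involve [s']: this is the commutativity of the squares in the cube of per-edge maps. *)
Lemma card_edge_rel_factor s s' s'' (v : basis s) (v'' : basis s'') :
    s \subset s' -> s' \subset s'' ->
  #|[pred v' : basis s' | edge_rel v v' && edge_rel v' v'']| = edge_rel v v''.
Proof.
move=> ss' s's''; have [vv''|] := boolP (edge_rel v v''); last first.
  apply: contraNeq; rewrite -lt0n => /card_gt0P[v' /andP[vv' v'v'']].
  exact: edge_rel_trans v'v''.
have [v' vv' v'v''] := edge_rel_factor ss' s's'' vv''.
apply: etrans (card1 v'); apply: eq_card => w; rewrite !inE.
apply/andP/eqP => [[vw _] | -> //]; exact: edge_rel_inj vw vv'.
Qed.

End EdgeRel.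

(** * The differential as a matrix indexed by states, and d o d = 0 *)

Section Differential.
Variable G : mgraph.
Implicit Types (s : {set 'I_(nlab G)}) (j k : 'I_(nlab G)).

(** At most one term survives. Taking [F] as a family over all indices lets the value be written at
    [tagged t], with no transport along [tag t = i]. *)
Lemma sum_Tagged (V : zmodType) (I : finType) (T : I -> finType)
    (F : forall i, T i -> V) (t : {i : I & T i}) i :
  \sum_(x : T i | t == Tagged T x) F i x =
    if tag t == i then F (tag t) (tagged t) else 0.
Proof.
case: t => i' y /=; case: eqP => [<- | ne]; last first.
  by apply: big_pred0 => x; apply/eqP => /(congr1 tag).
rewrite (big_pred1 y) // => x.
by rewrite /= eq_Tagged /= eq_sym.
Qed.

Definition edges_of i (t : state G i) : {set 'I_(nlab G)} := tag (val t).
Definition exps i (t : state G i) : basis (edges_of t) := tagged (val t).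

(** The sum has at most one term, since [j] must be the only element of [s' :\: s]. *)
Definition diff_sign s s' : int :=
  \sum_(j in edges G :\: s | s' == j |: s) edge_sign s j.

Definition diff_coef i i' (u : state G i) (t : state G i') : int :=
  diff_sign (edges_of u) (edges_of t) *+ edge_rel (exps u) (exps t).

Lemma incl_edge_map i s j (x : cochain G i) (t : state G i.+1) :
  incl i.+1 (edge_map j (proj s x)) t =
    \sum_(u : state G i | edges_of u == s)
       x u *+ ((edges_of t == j |: edges_of u) && edge_rel (exps u) (exps t)).
Proof.
(* Defined for every edge set [s'], so that [sum_Tagged] applies to it. *)
pose F s' (v' : basis s') :=
  \sum_(u : state G i | edges_of u == s) x u *+ edge_rel (exps u) v'.
rewrite ffunE (eq_bigr (F (j |: s))) => [|v' _]; last first.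
  rewrite ffunE /F big_mkcond.
  transitivity (\sum_(v : basis s) \sum_(u : state G i | val u == Tagged (@basis G) v)
     x u *+ edge_rel v v').
    by apply: eq_bigr => v _; rewrite ffunE; case: ifP => // _; rewrite big1.
  rewrite [LHS](exchange_big_dep predT) //= [RHS]big_mkcond /=.
  apply: eq_bigr => u _.
  exact: (sum_Tagged (fun s1 v1 => x u *+ @edge_rel _ s1 _ v1 v')).
rewrite (sum_Tagged F) /F -[tag _]/(edges_of t); case: ifPn => tE.
  by apply: eq_bigr => u /eqP uE; have -> : edges_of t == j |: edges_of u by rewrite uE.
rewrite big1 // => u /eqP uE.
by have /negPf-> : edges_of t != j |: edges_of u by rewrite uE.
Qed.

Lemma cochainMzE i (x : cochain G i) n t : (x *~ n) t = x t *~ n.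
Proof. exact: ffunMzE. Qed.

(** The form in which d o d = 0 and the chain map identities are checked: they become identities
    between coefficients. *)
Lemma diffE i (x : cochain G i) t : diff x t = \sum_u x u * diff_coef u t.
Proof.
rewrite /diff sum_ffunE.
rewrite [RHS](partition_big (@edges_of i)
  (fun s : {set 'I_(nlab G)} => (s \subset edges G) && (#|s| == i))); last first.
  by move=> u _; apply: (valP u).
apply: eq_bigr => s _; rewrite sum_ffunE.
under [LHS]eq_bigr => j _ do rewrite cochainMzE incl_edge_map mulrz_suml.
rewrite exchange_big /=; apply: eq_bigr => u /eqP <-.
rewrite /diff_coef /diff_sign mulrnAr -mulrnAl mulr_sumr [RHS]big_mkcondr /=.
apply: eq_bigr => j _; case: ifP => _; last by rewrite mulr0n mul0rz.
by rewrite mulrzz.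
Qed.

Lemma cards_sepU1 (T : finType) (P : pred T) (s : {set T}) (j : T) :
  j \notin s -> #|[set k in j |: s | P k]| = (P j + #|[set k in s | P k]|)%N.
Proof.
move=> js; rewrite (cardsD1 j) !inE eqxx /=; congr addn.
apply: eq_card => k; rewrite !inE; case: eqP => [-> | _] //=.
by rewrite (negPf js).
Qed.

Lemma edge_signU1 s j k : j \notin s ->
  edge_sign (j |: s) k = (-1) ^+ (j < k)%N * edge_sign s k.
Proof.
by move=> js; rewrite /edge_sign (@cards_sepU1 _ (fun j => (j < k)%N)) // exprD.
Qed.

(** The terms correspond to the ordered pairs of edges added to [s] to reach [s'']. Exchanging the
    two edges changes the sign, so the sum equals its own opposite and vanishes. *)
Lemma diff_sign_comp s s'' :
  \sum_s' diff_sign s s' * diff_sign s' s'' = 0.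
Proof.
(* [P j k] says that [s''] arises from [s] by adding two distinct new edges; [f j k] is the sign of
   adding [j] first and [k] second. *)
pose P j k := [&& j \in edges G :\: s, k \in edges G :\: s, j != k
  & s'' == j |: (k |: s)].
pose f j k : int := edge_sign s j * edge_sign (j |: s) k.
have PC j k : P j k = P k j.
  by rewrite /P andbCA (eq_sym j) setUCA.
have fC j k : P j k -> f j k = - f k j.
  case/and4P; rewrite !inE => /andP[js _] /andP[ks _] jk _.
  rewrite /f !edge_signU1 // mulrCA (mulrC (edge_sign s j)) (mulrCA (edge_sign s k)).
  rewrite -mulNr; congr (_ * _).
  (* Exactly one of [j < k] and [k < j] holds, so the extra signs on the two sides are opposite. *)
  by move: jk; rewrite -(inj_eq val_inj); case: ltngtP.
pose X := \sum_j \sum_(k | P j k) f j k.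
have X0 : X = - X.
  rewrite {1}/X (exchange_big_dep predT) //= -sumrN; apply: eq_bigr => k _.
  by rewrite -sumrN; apply: eq_big => [j | j /fC].
transitivity X; last by lia.
transitivity (\sum_(j in edges G :\: s) edge_sign s j * diff_sign (j |: s) s'').
  under eq_bigr => s' _ do rewrite mulr_suml.
  rewrite (exchange_big_dep (mem (edges G :\: s))) /=; last by move=> ? ? _ /andP[].
  apply: eq_bigr => j js; rewrite (big_pred1 (j |: s)) // => s'.
  by rewrite /= js.
rewrite big_mkcond; apply: eq_bigr => j _; case: ifP => js.
  rewrite mulr_sumr; apply: eq_bigl => k; rewrite /P js setUCA !inE negb_or (eq_sym k).
  by case: (j == k); rewrite /= ?andbF.
by rewrite big_pred0 // => k; rewrite /P js.
Qed.

Lemma val_tagged_inj i (u u' : state G i) :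
  Tagged (@basis G) (exps u) = Tagged (@basis G) (exps u') -> val u = val u'.
Proof. by rewrite /exps /edges_of; case: (val u) => s v; case: (val u'). Qed.

(** The states with edge set [s] are exactly the monomials of C^s, provided that [s] is a set of [i]
    edges of [G]. *)
Lemma sum_state i s (F : forall s, basis s -> int) :
    s \subset edges G -> #|s| = i ->
  \sum_(u : state G i | edges_of u == s) F (edges_of u) (exps u)
    = \sum_(v : basis s) F s v.
Proof.
move=> sE si.
transitivity (\sum_(u : state G i) \sum_(v : basis s | val u == Tagged (@basis G) v) F s v).
  by rewrite big_mkcond; apply: eq_bigr => u _; rewrite (sum_Tagged F).
rewrite (exchange_big_dep predT) //=; apply: eq_bigr => v _.
have vP : (s \subset edges G) && (#|s| == i) by rewrite sE si eqxx.
pose u : state G i := exist _ (Tagged (@basis G) v) vP.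
by rewrite (big_pred1 u).
Qed.

Lemma diff_sign_neq0 s s' : diff_sign s s' != 0 ->
  exists2 j, j \in edges G :\: s & s' = j |: s.
Proof.
apply: contra_neqP => nj; rewrite /diff_sign big1 // => j /andP[js /eqP s'E].
by case: nj; exists j.
Qed.

(** Group the intermediate states by their edge set [s']. By [card_edge_rel_factor] each group
    contributes its sign product times a factor independent of [s'], and the sign products sum to 0
    by [diff_sign_comp]. *)
Lemma diff_coef_comp i (u : state G i) (t : state G i.+2) :
  \sum_(u' : state G i.+1) diff_coef u u' * diff_coef u' t = 0.
Proof.
rewrite (partition_big (@edges_of i.+1) predT) //=.
pose F s' (v' : basis s') : int := diff_sign (edges_of u) s' * diff_sign s' (edges_of t)
  *+ (edge_rel (exps u) v' && edge_rel v' (exps t)).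
under eq_bigr => s' _.
  rewrite (eq_bigr (fun u' => F (edges_of u') (exps u'))); last first.
    by move=> u' _; rewrite /diff_coef mulrnAl mulrnAr -mulrnA mulnb andbC.
  over.
rewrite (eq_bigr (fun s' => diff_sign (edges_of u) s' * diff_sign s' (edges_of t)
    *+ edge_rel (exps u) (exps t))) => [|s' _].
  by rewrite sumrMnl diff_sign_comp mul0rn.
(* A nonzero sign product provides the inclusions under which the intermediate monomials can be
   counted. *)
have [z | nz] := eqVneq (diff_sign (edges_of u) s' * diff_sign s' (edges_of t)) 0.
  by rewrite z mul0rn big1 // => u' /eqP u'E; move: z; rewrite -u'E /F => ->; rewrite mul0rn.
move: (nz); rewrite mulf_eq0 negb_or => /andP[].
move=> /diff_sign_neq0[j jE s'E] /diff_sign_neq0[k _ tE].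
have ss' : edges_of u \subset s' by rewrite s'E subsetUr.
have s't : s' \subset edges_of t by rewrite tE subsetUr.
have /andP[uE /eqP ui] := valP u; move: jE; rewrite inE => /andP[ju jE].
rewrite sum_state; last 2 first.
- by rewrite s'E subUset sub1set jE.
- by rewrite s'E cardsU1 ju /edges_of ui.
rewrite /F sumrMnr -(card_edge_rel_factor _ _ ss' s't) -sum1_card.
by congr (_ *+ _); rewrite [RHS]big_mkcond; apply: eq_bigr => v' _; rewrite inE; case: ifP.
Qed.

Lemma diff_diff i (x : cochain G i) : diff (diff x) = 0.
Proof.
apply/ffunP=> t; rewrite diffE ffunE.
under eq_bigr => u _ do rewrite diffE mulr_suml.
rewrite exchange_big big1 //= => u _.
under eq_bigr => u' _ do rewrite -mulrA.
by rewrite -mulr_sumr diff_coef_comp mulr0.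
Qed.

End Differential.

(** * Contraction of a non-loop edge: components, cycle rank and monomials *)

Section Contraction.
Variables (G : mgraph) (e : 'I_(nlab G)).
Notation H := (contract e).
Notation comp := Defs.comp.
Implicit Types (s : {set 'I_(nlab G)}) (u v : vert G).

Lemma contr_proj_eq u v :
  (contr_proj e u == contr_proj e v) =
    (u == v) || (u \in [set (ends e).1; (ends e).2])
             && (v \in [set (ends e).1; (ends e).2]).
Proof.
rewrite -val_eqE /= /contr_class.
have [-> | ne_uv] := eqVneq u v; first by rewrite eqxx.
case: ifPn => ue; case: ifPn => ve; rewrite ?eqxx //=; apply/eqP => E.
- by move: ve; rewrite E set11.
- by move: ue; rewrite -E set11.
- by case/eqP: ne_uv; apply/set1P; rewrite -E set11.
Qed.

Lemma contr_proj_surj (x : vert H) : exists v, x = contr_proj e v.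
Proof.
case: x => B cB; have /codomP[v BE] := cB.
by exists v; apply: val_inj.
Qed.

(** Distinct vertices with the same class are the two ends of [e], which [e] itself joins. *)
Lemma contr_proj_connect s u v :
  contr_proj e u = contr_proj e v -> connect (adj (e |: s)) u v.
Proof.
move/eqP; rewrite contr_proj_eq => /predU1P[-> // |].
rewrite !inE => /andP[ue ve].
have e12 : connect (adj (e |: s)) (ends e).1 (ends e).2.
  apply/connect1/exists_inP; exists e; first exact: setU11.
  by rewrite -surjective_pairing eqxx.
by case/orP: ue => /eqP->; case/orP: ve => /eqP-> //; rewrite connect_adj_sym.
Qed.

(** A path in the contraction lifts to [G] by inserting [e] where two vertices have been identified;
    conversely the steps of a path along [e] collapse to a point. *)
Lemma contr_connect s u v :
  connect (adj (G := H) s) (contr_proj e u) (contr_proj e v)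
    = connect (adj (e |: s)) u v.
Proof.
apply/idP/idP => /connectP[p].
  elim: p u => [|y p IHp] u /=; first by move=> _ /esym/contr_proj_connect.
  have [w ->] := contr_proj_surj y => /andP[/exists_inP[f fs /= fE] pw vE].
  apply: connect_trans (IHp w pw vE).
  have f12 : connect (adj (e |: s)) (@ends G f).1 (@ends G f).2.
    apply/connect1/exists_inP; exists f; first exact: setU1r.
    by rewrite -surjective_pairing eqxx.
  rewrite !xpair_eqE in fE.
  case/orP: fE => /andP[/eqP/(contr_proj_connect s) fu /eqP/(contr_proj_connect s) fw].
    by rewrite connect_adj_sym in fu; apply: connect_trans fu (connect_trans f12 fw).
  rewrite connect_adj_sym in f12; rewrite connect_adj_sym in fw.
  exact: connect_trans fw (connect_trans f12 fu).
elim: p u => [|w p IHp] u /=; first by move=> _ ->.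
move=> /andP[/exists_inP[f fs fE] pw vE]; apply: connect_trans (IHp w pw vE).
case/setU1P: fs => [fe | fs].
  rewrite (_ : contr_proj e u = contr_proj e w) //.
  apply/eqP; rewrite contr_proj_eq !inE; subst f.
  by case/orP: fE => /eqP->; rewrite !eqxx ?orbT.
apply/connect1/exists_inP; exists f => //=.
by case/orP: fE => /eqP->; rewrite !eqxx ?orbT.
Qed.

Definition contr_comp s (c : comp (e |: s)) : comp (G := H) s :=
  component (G := H) s (contr_proj e (xchoose (componentP c))).

Lemma mem_contr_comp s (c : comp (e |: s)) v :
  (contr_proj e v \in val (contr_comp c)) = (v \in val c).
Proof.
rewrite (mem_component (G := H)) contr_connect -mem_component.
by rewrite -(eqP (xchooseP (componentP c))).
Qed.

Lemma sub_contr_comp s s' (c : comp (e |: s)) (c' : comp (e |: s')) :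
  (val (contr_comp c) \subset val (contr_comp c')) = (val c \subset val c').
Proof.
apply/subsetP/subsetP => [cc' v | cc' x].
  by rewrite -!mem_contr_comp; apply: cc'.
by have [v ->] := contr_proj_surj x; rewrite !mem_contr_comp; apply: cc'.
Qed.

Lemma contr_compE s (c : comp (e |: s)) :
  val (contr_comp c) = contr_proj e @: val c.
Proof.
apply/setP=> x; have [v ->] := contr_proj_surj x; rewrite mem_contr_comp.
apply/idP/imsetP => [vc | [u uc /(contr_proj_connect s) vu]]; first by exists v.
move: uc; rewrite !mem_comp => /eqP->; rewrite -mem_comp mem_component.
by rewrite connect_adj_sym.
Qed.

Lemma contr_comp_bij s : bijective (@contr_comp s).
Proof.
have inj : injective (@contr_comp s).
  move=> c d cd; have /eqP cE := xchooseP (componentP c).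
  apply/esym/eqP; rewrite cE -mem_comp -mem_contr_comp -cd mem_contr_comp.
  by rewrite mem_comp -cE.
have surj (c' : comp (G := H) s) : exists c, contr_comp c == c'.
  have [x /eqP c'E] := componentP c'; have [v xE] := contr_proj_surj x.
  exists (component (e |: s) v).
  by rewrite c'E xE -mem_comp mem_contr_comp mem_component.
exists (fun c' => xchoose (surj c')) => c; last exact/eqP/(xchooseP (surj c)).
exact/inj/eqP/(xchooseP (surj _)).
Qed.

Hypothesis e_nloop : ~~ is_loop e.

(** The linear extension of [contr_proj] to the vertex spaces, acting on row vectors. *)
Definition proj_mx : 'M[rat]_(#|vert G|, #|vert H|) :=
  \matrix_(i, k) (enum_val k == contr_proj e (enum_val i))%:R.

Lemma mul_edge_row_proj j :
  edge_row (G := G) j *m proj_mx = edge_row (G := H) j.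
Proof.
apply/rowP=> k; rewrite !mxE.
have pick_vert (v : vert G) (F : vert G -> rat) :
    \sum_(i < #|vert G|) (enum_val i == v)%:R * F (enum_val i) = F v.
  rewrite (bigD1 (enum_rank v)) //= enum_rankK eqxx mul1r big1 ?addr0 // => i.
  by rewrite -(inj_eq enum_val_inj) enum_rankK => /negPf->; rewrite mul0r.
under eq_bigr => i _ do rewrite !mxE mulrBl.
rewrite sumrB.
by rewrite !(pick_vert _ (fun v => (enum_val k == contr_proj e v)%:R)).
Qed.

Lemma edge_row_contr : edge_row (G := H) e = 0.
Proof.
apply/rowP=> k; rewrite !mxE /=.
suff -> : contr_proj e (ends e).2 = contr_proj e (ends e).1 by rewrite subrr.
by apply/eqP; rewrite contr_proj_eq !inE !eqxx !orbT.
Qed.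

(** The projection kills the row of [e], whose ends are identified, and carries every other row to
    the row of the same edge in the contraction. *)
Lemma boundary_contr s : e \notin s ->
  (boundary (e |: s) *m proj_mx :=: boundary (G := H) s)%MS.
Proof.
move=> es; apply/eqmxP/andP; split.
  apply/row_subP=> i; rewrite row_mul row_boundary mul_edge_row_proj.
  have := enum_valP i; case/setU1P=> [-> | /(@edge_row_boundary H) //].
  by rewrite edge_row_contr sub0mx.
apply: (@boundary_subP H) => j js; rewrite -mul_edge_row_proj submxMr //.
by rewrite edge_row_boundary // inE js orbT.
Qed.

(** A vector killed by the projection sums to 0 over each class of vertices. Classes other than the
    ends of [e] are singletons, so it is supported on these two ends, with opposite values: a
    multiple of the boundary of [e]. *)
Lemma kermx_proj s : (boundary (e |: s) :&: kermx proj_mx :=: edge_row e)%MS.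
Proof.
apply/eqmxP/andP; split; last first.
  rewrite sub_capmx edge_row_boundary ?setU11 //; apply/sub_kermxP.
  by rewrite mul_edge_row_proj edge_row_contr.
apply: submx_trans (capmxSr _ _) _; apply/row_subP=> i.
have := row_sub i (kermx proj_mx) => /sub_kermxP; move: (row i _) => x xP.
(* The scalar is the coordinate at the second end of [e], where [edge_row e] has entry 1. *)
apply/sub_rVP; exists (x 0 (enum_rank (ends e).2)).
have xE w : \sum_(i | contr_proj e (enum_val i) == w) x 0 i = 0.
  move/rowP: xP => /(_ (enum_rank w)); rewrite !mxE => xw; rewrite -[RHS]xw.
  rewrite [LHS]big_mkcond; apply: eq_bigr => k _.
  by rewrite mxE enum_rankK eq_sym; case: ifP; rewrite ?mulr1 ?mulr0.
have a_b : (ends e).1 != (ends e).2 by [].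
apply/rowP=> k; rewrite !mxE; set v := enum_val k.
have -> : k = enum_rank v by rewrite enum_valK.
have [vE | v_ab] := boolP (v \in [set (ends e).1; (ends e).2]); last first.
  have := xE (contr_proj e v); rewrite (big_pred1 (enum_rank v)) => [-> | l].
    by move: v_ab; rewrite !inE negb_or => /andP[/negPf-> /negPf->]; rewrite subrr mulr0.
  by rewrite contr_proj_eq (negPf v_ab) andbF orbF (can2_eq (@enum_valK _) (@enum_rankK _)).
have xab : x 0 (enum_rank (ends e).1) + x 0 (enum_rank (ends e).2) = 0.
  rewrite -(xE (contr_proj e (ends e).1)) (bigD1 (enum_rank (ends e).1)) ?enum_rankK //.
  congr (_ + _); rewrite (big_pred1 (enum_rank (ends e).2)) // => l.
  rewrite /= contr_proj_eq -!(can2_eq (@enum_valK _) (@enum_rankK _)) !inE eqxx andbT /=.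
  by case: eqP => [-> | _] /=; rewrite ?(negPf a_b) ?andbT.
case/set2P: vE => vE; rewrite vE.
  rewrite eqxx (negPf a_b) sub0r mulrN1; apply/eqP.
  by rewrite -addr_eq0 xab.
by rewrite eqxx eq_sym (negPf a_b) subr0 mulr1.
Qed.

(** By rank-nullity the projection lowers the rank of the boundary by 1, as the boundary of a
    non-loop is nonzero; the number of edges drops by 1 as well. *)
Lemma betti1_contr s : e \notin s -> betti1 (G := H) s = betti1 (e |: s).
Proof.
move=> es; rewrite !betti1E -(mxrank_mul_ker (boundary (e |: s)) proj_mx).
rewrite (boundary_contr es) (kermx_proj s) rank_rV.
suff -> : edge_row e != 0 by rewrite cardsU1 es addnC subnDr.
apply/eqP=> /rowP/(_ (enum_rank (ends e).2)) /eqP.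
by rewrite !mxE enum_rankK eqxx (eq_sym (ends e).2) -/(is_loop e) (negPf e_nloop) subr0 oner_eq0.
Qed.

(** Reading exponents at plain natural numbers allows comparison of families indexed by ['I_n] and
    ['I_n'] when [n = n'] is only a provable equality. *)
Definition exp_at n (b : {ffun 'I_n -> 'I_2}) (k : nat) : 'I_2 :=
  if insub k is Some k' then b k' else ord0.

Lemma exp_atE n (b : {ffun 'I_n -> 'I_2}) (k : 'I_n) : exp_at b k = b k.
Proof. by rewrite /exp_at valK. Qed.

Lemma exp_at_out n (b : {ffun 'I_n -> 'I_2}) k : (n <= k)%N -> exp_at b k = ord0.
Proof. by move=> nk; rewrite /exp_at insubN // -leqNgt. Qed.

Lemma exp_at_eq n n' (b : {ffun 'I_n -> 'I_2}) k :
  n = n' -> exp_at [ffun l : 'I_n' => exp_at b l] k = exp_at b k.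
Proof.
move=> nn'; have [kn | nk] := ltnP k n'; last by rewrite !exp_at_out ?nn'.
by rewrite (exp_atE _ (Ordinal kn)) ffunE.
Qed.

(** The function whose graph is the relation [contr_match], as [contr_matchE] shows. *)
Definition uncontract s (w : basis (G := H) s) : basis (e |: s) :=
  ([ffun c => w.1 (contr_comp c)], [ffun k : 'I_(betti1 (e |: s)) => exp_at w.2 k]).

Lemma uncontract_bij s : e \notin s -> bijective (@uncontract s).
Proof.
move=> es; have [g gK Kg] := contr_comp_bij s.
exists (fun v : basis (e |: s) => ([ffun c' => v.1 (g c')],
  [ffun k : 'I_(betti1 (G := H) s) => exp_at v.2 k]) : basis (G := H) s).
  move=> [a b]; congr (_, _); apply/ffunP=> x; rewrite !ffunE ?Kg //=.
  by rewrite exp_at_eq ?betti1_contr // exp_atE.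
move=> [a b]; congr (_, _); apply/ffunP=> x; rewrite !ffunE ?gK //=.
by rewrite exp_at_eq ?betti1_contr // exp_atE.
Qed.

Lemma contr_matchE s (w : basis (G := H) s) (v : basis (e |: s)) :
  e \notin s -> contr_match w v = (v == uncontract w).
Proof.
move=> es; apply/andP/eqP => [[/forallP av /forallP bv] | ->]; last first.
  split; apply/forallP=> x; apply/forallP=> y; apply/implyP=> /eqP xy.
    by rewrite ffunE -contr_compE in xy *; rewrite (val_inj xy).
  by rewrite ffunE -xy exp_atE.
case: v av bv => a b /= av bv; congr (_, _); apply/ffunP=> x; rewrite ffunE.
  by have /forallP/(_ (contr_comp x)) := av x; rewrite contr_compE eqxx => /eqP.
have xb : (x < betti1 (G := H) s)%N by rewrite betti1_contr.
have /forallP/(_ (Ordinal xb)) := bv x; rewrite eqxx => /eqP <-.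
by rewrite -exp_atE.
Qed.

(** [contr_comp] preserves and reflects inclusion of components, so the sums of x-exponents agree;
    the y-exponents are compared by position, and the Betti numbers are equal. *)
Lemma edge_rel_uncontract s s' (w : basis (G := H) s) (w' : basis (G := H) s') :
    e \notin s -> e \notin s' ->
  edge_rel (uncontract w) (uncontract w') = edge_rel w w'.
Proof.
move=> es es'; have [g gK Kg] := contr_comp_bij s'.
have sumE (c' : comp (e |: s')) :
    (\sum_(c : comp (e |: s) | val c \subset val c') (uncontract w).1 c =
    \sum_(c : comp (G := H) s | val c \subset val (contr_comp c')) w.1 c)%N.
  rewrite [RHS](reindex (@contr_comp s)); last exact/onW_bij/contr_comp_bij.
  by apply: eq_big => [c | c _]; rewrite ?sub_contr_comp ?ffunE.
apply/edge_relP/edge_relP => -[av bv]; split.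
- by move=> c'; rewrite -[c']Kg -sumE -av ffunE.
- move=> k'; have k'b : (k' < betti1 (e |: s'))%N by rewrite -betti1_contr.
  have := bv (Ordinal k'b); rewrite ffunE exp_atE => ->.
  by rewrite -/(exp_at _ _) exp_at_eq // betti1_contr.
- by move=> c'; rewrite sumE -av ffunE.
move=> k'; have k'b : (k' < betti1 (G := H) s')%N by rewrite betti1_contr.
rewrite -/(exp_at _ _) exp_at_eq ?betti1_contr // ffunE.
by have := bv (Ordinal k'b); rewrite -exp_atE.
Qed.

Lemma contr_id_uncontract s (y : Csub (G := H) s) w :
  e \notin s -> contr_id y (uncontract w) = y w.
Proof.
move=> es; rewrite ffunE (big_pred1 w) // => w'.
by rewrite contr_matchE // eq_sym (inj_eq (bij_inj (uncontract_bij es))).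
Qed.

Lemma contr_id_bij s : e \notin s -> bijective (@contr_id G e s).
Proof.
move=> es; have [g gK Kg] := uncontract_bij es.
exists (fun z : Csub (e |: s) => [ffun w => z (uncontract w)] : Csub (G := H) s) => y.
  by apply/ffunP=> w; rewrite ffunE contr_id_uncontract.
by apply/ffunP=> v; rewrite -[v]Kg contr_id_uncontract // ffunE.
Qed.

Lemma sum_uncontract_x s (w : basis (G := H) s) :
  (\sum_c (uncontract w).1 c = \sum_c w.1 c)%N.
Proof.
rewrite [RHS](reindex (@contr_comp s)); last exact/onW_bij/contr_comp_bij.
by apply: eq_bigr => c _; rewrite ffunE.
Qed.

Lemma sum_uncontract_y s (w : basis (G := H) s) : e \notin s ->
  (\sum_k (uncontract w).2 k = \sum_k w.2 k)%N.
Proof.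
move=> es; under eq_bigr => k _ do rewrite ffunE.
rewrite -(big_mkord xpredT (fun k => exp_at w.2 k : nat)) -betti1_contr // big_mkord.
by apply: eq_bigr => k _; rewrite exp_atE.
Qed.

End Contraction.

(** * Signed extension by zero and restriction along a partition of a basis *)

Section PushPull.
Variables (I J K : finType) (h : I -> J) (g : K -> J) (c : I -> int).
Hypotheses (hI : injective h) (gI : injective g).
Hypothesis gP : forall j, (forall i, h i != j) <-> exists k, g k = j.
Hypothesis c2 : forall i, c i * c i = 1.

Definition push (x : {ffun I -> int}) : {ffun J -> int} :=
  [ffun j => \sum_(i | h i == j) x i * c i].

Definition pull (y : {ffun J -> int}) : {ffun K -> int} := [ffun k => y (g k)].

Lemma pushE x i : push x (h i) = x i * c i.
Proof.
by rewrite ffunE (big_pred1 i) // => i'; rewrite /= (inj_eq hI).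
Qed.

Lemma push_out x j : (forall i, h i != j) -> push x j = 0.
Proof. by move=> hj; rewrite ffunE big_pred0 // => i; rewrite (negPf (hj i)). Qed.

Lemma push_supp x j : push x j != 0 -> exists2 i, h i = j & x i != 0.
Proof.
have [/'exists_eqP[i <-] | /existsPn hj] := boolP [exists i, h i == j].
  rewrite pushE => xi; exists i => //.
  by apply: contra_neq xi => ->; rewrite mul0r.
by rewrite push_out ?eqxx.
Qed.

Lemma push_is_zmod_morphism : zmod_morphism push.
Proof.
move=> x y; apply/ffunP=> j; rewrite !ffunE -sumrB.
by apply: eq_bigr => i _; rewrite !ffunE mulrBl.
Qed.

Lemma pull_is_zmod_morphism : zmod_morphism pull.
Proof. by move=> x y; apply/ffunP=> k; rewrite !ffunE. Qed.

Lemma push_inj : injective push.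
Proof.
move=> x y /ffunP xy; apply/ffunP=> i; have := xy (h i).
by rewrite !pushE => /(congr1 ( *%R^~ (c i))); rewrite -!mulrA !c2 !mulr1.
Qed.

Lemma pull_push x : pull (push x) = 0.
Proof.
apply/ffunP=> k; rewrite [LHS]ffunE [RHS]ffunE push_out //.
by apply/gP; exists k.
Qed.

Lemma push_pull_exact y : pull y = 0 <-> exists x, push x = y.
Proof.
split=> [y0 | [x <-]]; last exact: pull_push.
(* Each [c i] is its own inverse, so multiplying by it undoes the twist in [push]. *)
exists [ffun i => y (h i) * c i]; apply/ffunP=> j.
have [/'exists_eqP[i <-] | /existsPn hj] := boolP [exists i, h i == j].
  by rewrite pushE ffunE -mulrA c2 mulr1.
rewrite push_out //; have /gP[k <-] := hj.
by move/ffunP/(_ k): y0; rewrite !ffunE.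
Qed.

Lemma pull_surj x : exists y, pull y = x.
Proof.
exists [ffun j => \sum_(k | g k == j) x k]; apply/ffunP=> k; rewrite !ffunE.
by rewrite (big_pred1 k) // => k'; rewrite /= (inj_eq gI).
Qed.

End PushPull.

(** * Compatibility of [push] and [pull] with maps given by matrices *)

Lemma sum_image (I J : finType) (h : I -> J) (F : J -> int) :
    injective h -> (forall j, F j != 0 -> exists i, h i = j) ->
  \sum_j F j = \sum_i F (h i).
Proof.
move=> hI hF; rewrite -(big_imset F (in2W hI)) /= [RHS]big_mkcond /=.
apply: eq_bigr => j _; case: imsetP => // nj; apply/eqP; apply: contra_notT nj.
by move/hF => [i <-]; exists i.
Qed.

Section MatrixMorphism.
Variables (I I' J J' : finType) (a : I -> I' -> int) (b : J -> J' -> int).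
Variables (dI : {ffun I -> int} -> {ffun I' -> int}).
Variables (dJ : {ffun J -> int} -> {ffun J' -> int}).
Hypothesis dIE : forall x i', dI x i' = \sum_i x i * a i i'.
Hypothesis dJE : forall y j', dJ y j' = \sum_j y j * b j j'.

(** The last hypothesis says that no coefficient leads out of the image of [h]: the pushed functions
    form a subcomplex, on which the two matrices agree up to the signs. *)
Lemma push_commute (h : I -> J) (h' : I' -> J') c c' x :
    injective h -> injective h' ->
    (forall i i', c i * b (h i) (h' i') = a i i' * c' i') ->
    (forall i j', (forall i', h' i' != j') -> b (h i) j' = 0) ->
  dJ (push h c x) = push h' c' (dI x).
Proof.
move=> hI h'I ab b0; apply/ffunP=> j'; rewrite dJE.
rewrite (sum_image hI) => [|j]; last first.
  move=> nz; suff /push_supp : push h c x j != 0 by case=> // i <-; exists i.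
  by apply: contra_neq nz => ->; rewrite mul0r.
have [/'exists_eqP[i' <-] | /existsPn hj] := boolP [exists i', h' i' == j'].
  rewrite pushE // dIE mulr_suml; apply: eq_bigr => i _.
  by rewrite pushE // -!mulrA ab.
by rewrite push_out // big1 // => i _; rewrite b0 ?mulr0.
Qed.

(** Dually, nonzero coefficients into the image of [g'] start only from the image of [g], so the
    values of [y] elsewhere do not affect the left side. *)
Lemma pull_commute (g : I -> J) (g' : I' -> J') y :
    injective g -> (forall i i', b (g i) (g' i') = a i i') ->
    (forall j i', b j (g' i') != 0 -> exists i, g i = j) ->
  pull g' (dJ y) = dI (pull g y).
Proof.
move=> gI ab b0; apply/ffunP=> i'; rewrite ffunE dJE dIE.
rewrite (sum_image gI) => [|j nz]; last first.
  by apply: (b0 j i'); apply: contra_neq nz => ->; rewrite mulr0.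
by apply: eq_bigr => i _; rewrite ffunE ab.
Qed.

End MatrixMorphism.

(** * States containing or avoiding [e], and the coefficients of the differential between them *)

Section ShortExact.
Variables (G : mgraph) (e : 'I_(nlab G)).
Hypotheses (eG : e \in edges G) (e_nloop : ~~ is_loop e).
Notation H := (contract e).
Notation D := (delete e).
Implicit Types s : {set 'I_(nlab G)}.

Lemma edges_ofP (K : mgraph) i (t : state K i) :
  edges_of t \subset edges K /\ #|edges_of t| = i.
Proof. by have /andP[? /eqP] := valP t. Qed.

Lemma notin_edges_contr s : s \subset edges H -> e \notin s.
Proof. by move=> sH; apply/negP=> /(subsetP sH); rewrite !inE eqxx. Qed.

Lemma notin_edges_of i (w : state H i) : e \notin edges_of w.
Proof. exact: notin_edges_contr (edges_ofP w).1. Qed.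

Lemma lift_state_subproof i (w : state H i) :
  (e |: edges_of w \subset edges G) && (#|e |: edges_of w| == i.+1).
Proof.
have [wH wi] := edges_ofP w; rewrite cardsU1 notin_edges_of.
rewrite subUset sub1set eG (subset_trans wH) ?subsetDl //=.
by rewrite -[X in _ == X.+1]wi.
Qed.

Definition lift_state i (w : state H i) : state G i.+1 :=
  exist _ (Tagged (@basis G) (uncontract (exps w))) (lift_state_subproof w).

Lemma Tagged_uncontract_inj s s' (w : basis (G := H) s) (w' : basis (G := H) s') :
    e \notin s -> e \notin s' ->
    Tagged (@basis G) (uncontract w) = Tagged (@basis G) (uncontract w') ->
  Tagged (@basis H) w = Tagged (@basis H) w'.
Proof.
move=> es es' E; have ss' : s = s'.
  by have /= := congr1 tag E => tE; rewrite -(setU1K es) -(setU1K es') tE.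
subst s'; move/eqP: E; rewrite eq_Tagged /= => /eqP E.
by rewrite (bij_inj (uncontract_bij e_nloop es) E).
Qed.

Lemma lift_state_inj i : injective (@lift_state i).
Proof.
move=> w w' /(congr1 val) /= E; apply: val_inj.
exact (val_tagged_inj (Tagged_uncontract_inj (notin_edges_of w) (notin_edges_of w') E)).
Qed.

Lemma lift_stateP i (t : state G i.+1) :
  reflect (exists w, lift_state w = t) (e \in edges_of t).
Proof.
apply: (iffP idP) => [|[w <-]]; last by rewrite setU11.
case: t => [[s v] sP]; rewrite /edges_of /= => es.
(* With [s :\ e] abstracted to a variable, [s] can be substituted, and [v] then has the type on
   which the inverse of [uncontract] acts. *)
have sE : s = e |: (s :\ e) by rewrite setD1K.
have e's : e \notin s :\ e by rewrite setD11.
move: (s :\ e) e's sE => s' es' sE; subst s.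
have [g gK Kg] := uncontract_bij e_nloop es'.
have s'P : (s' \subset edges H) && (#|s'| == i).
  have /andP[] := sP; rewrite /= cardsU1 es' add1n eqSS subUset => /andP[_ s'G] si.
  by rewrite subsetD1 s'G es' si.
exists (exist _ (Tagged (@basis H) (g v)) s'P).
by apply: val_inj; rewrite /= /exps /= Kg.
Qed.

(** The same tagged monomial serves in [G], because [basis] does not depend on [edges], the only
    field that [delete] changes. *)
Definition emb_state i (u : state D i) : state G i :=
  exist _ (val u)
    (let: conj uD ui := andP (valP u) in
     introT andP (conj (subset_trans uD (subsetDl _ _)) ui)).

Lemma emb_state_inj i : injective (@emb_state i).
Proof. by move=> u u' /(congr1 val) /= /val_inj. Qed.

Lemma emb_stateP i (t : state G i) :
  reflect (exists u, emb_state u = t) (e \notin edges_of t).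
Proof.
apply: (iffP idP) => [et | [u <-]]; last first.
  by have [/subsetD1P[]] := edges_ofP u.
have [tG ti] := edges_ofP t.
have tP : (tag (val t) \subset edges D) && (#|tag (val t)| == i).
  by rewrite subsetD1 tG et ti /=.
by exists (exist _ (val t) tP); apply: val_inj.
Qed.


(** The partition of the states required for [push_pull_exact]. *)
Lemma lift_state_out i (t : state G i.+1) :
  (forall w, lift_state w != t) <-> exists u, emb_state u = t.
Proof.
split=> [nt | /emb_stateP et w].
  by apply/emb_stateP/lift_stateP => -[w /eqP]; apply/negP/nt.
by apply: contra et => /eqP wt; apply/lift_stateP; exists w.
Qed.

(** Passing from [s] to [e |: s] changes [edge_sign] by -1 exactly when [e < j], and passing from
    [s] to [j |: s] changes [contr_sign] by the same factor. *)
Lemma edge_sign_contr s j : e \notin s -> j \notin s ->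
  contr_sign e s * edge_sign (G := G) (e |: s) j
    = edge_sign (G := G) s j * contr_sign e (j |: s).
Proof.
move=> es js; rewrite edge_signU1 // /contr_sign.
rewrite (@cards_sepU1 _ (fun k : 'I_(nlab G) => (e < k)%N)) // exprD.
by rewrite mulrCA [RHS]mulrCA (mulrC (edge_sign _ _)).
Qed.

Lemma diff_sign_contr s s' : e \notin s -> e \notin s' ->
  contr_sign e s * diff_sign (G := G) (e |: s) (e |: s')
    = diff_sign (G := H) s s' * contr_sign e s'.
Proof.
move=> es es'; rewrite /diff_sign mulr_sumr mulr_suml.
apply: eq_big => [j | j /andP[]]; rewrite /= !inE negb_or.
  have [-> | je] /= := eqVneq j e; first by rewrite andbF.
  have [//|js] /= := boolP (j \in s); congr (_ && _).
  apply/eqP/eqP => [|->]; last by rewrite setUCA.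
  rewrite setUCA => /(congr1 (fun A => A :\ e)); rewrite !setU1K //.
  by rewrite !inE negb_or eq_sym je.
case/andP=> /andP[je js] jG; rewrite setUCA => /eqP /(congr1 (fun A => A :\ e)).
rewrite !setU1K //; last by rewrite !inE negb_or eq_sym je.
by move=> ->; rewrite edge_sign_contr.
Qed.

Lemma diff_coef_lift i (w : state H i) (w' : state H i.+1) :
  contr_sign e (edges_of w) * diff_coef (lift_state w) (lift_state w')
    = diff_coef w w' * contr_sign e (edges_of w').
Proof.
have [ew ew'] := (notin_edges_of w, notin_edges_of w').
have rE : edge_rel (exps (lift_state w)) (exps (lift_state w'))
    = edge_rel (exps w) (exps w').
  exact (edge_rel_uncontract e_nloop (exps w) (exps w') ew ew').
have dE : contr_sign e (edges_of w)
    * diff_sign (edges_of (lift_state w)) (edges_of (lift_state w'))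
    = diff_sign (edges_of w) (edges_of w') * contr_sign e (edges_of w').
  exact (diff_sign_contr ew ew').
by rewrite /diff_coef rE mulrnAr dE mulrnAl.
Qed.

(** The differential only adds edges, so it never leaves the sets containing [e]. *)
Lemma diff_coef_lift_out i (w : state H i) (t : state G i.+2) :
  (forall w', lift_state w' != t) -> diff_coef (lift_state w) t = 0.
Proof.
move=> /lift_state_out/emb_stateP et; rewrite /diff_coef.
have [-> | /diff_sign_neq0[j _ tE]] :=
  eqVneq (diff_sign (edges_of (lift_state w)) (edges_of t)) 0.
  exact: mul0rn.
by case/negP: et; rewrite tE !inE eqxx orbT.
Qed.

Lemma diff_sign_delete s s' :
  e \notin s' -> diff_sign (G := D) s s' = diff_sign (G := G) s s'.
Proof.
move=> es'; apply: eq_bigl => j; rewrite !inE.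
have [s'E | _] := eqVneq s' (j |: s); last by rewrite !andbF.
have -> // : j != e by apply: contraNneq es' => je; rewrite s'E je setU11.
Qed.

Lemma diff_coef_emb i (u : state D i) (u' : state D i.+1) :
  diff_coef (emb_state u) (emb_state u') = diff_coef u u'.
Proof.
(* The two sides are convertible: deletion only changes [edges]. *)
have rE : edge_rel (exps (emb_state u)) (exps (emb_state u'))
    = edge_rel (exps u) (exps u') by exact erefl.
have eu' : e \notin edges_of (emb_state u') by apply/emb_stateP; exists u'.
have dE : diff_sign (edges_of u) (edges_of u')
    = diff_sign (edges_of (emb_state u)) (edges_of (emb_state u')).
  exact (diff_sign_delete _ eu').
by rewrite /diff_coef rE dE.
Qed.

(** Since edges are only added, a set avoiding [e] is reached only from sets avoiding [e]. *)
Lemma diff_coef_emb_out i (t : state G i) (u : state D i.+1) :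
  diff_coef t (emb_state u) != 0 -> exists u', emb_state u' = t.
Proof.
move=> nz; apply/emb_stateP.
have eu : e \notin edges_of (emb_state u) by apply/emb_stateP; exists u.
have /diff_sign_neq0[j _ uE] :
    diff_sign (edges_of t) (edges_of (emb_state u)) != 0.
  by apply: contra_neq nz => z; rewrite /diff_coef z mul0rn.
by apply: contra eu => et; rewrite uE !inE et orbT.
Qed.

End ShortExact.

(** * Cohomology classes and additive maps defined through representatives *)

(** Two values at the same argument differ by a value at 0, so single-valuedness need only be
    checked there. Maps on cohomology are obtained in this way from relations between
    representatives. *)
Lemma additive_of_rel (U V : zmodType) (R : U -> V -> Prop) :
    (forall u, exists v, R u v) ->
    (forall u u' v v', R u v -> R u' v' -> R (u - u') (v - v')) ->
    (forall v, R 0 v -> v = 0) ->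
  exists f : {additive U -> V}, forall u v, R u v <-> f u = v.
Proof.
move=> /choice[f fR] RB R0.
have Rf u v : R u v <-> f u = v.
  split=> [uv | <- //]; apply/eqP; rewrite -subr_eq0; apply/eqP/R0.
  by rewrite -(subrr u); apply: RB.
have f_additive : zmod_morphism f by move=> u u'; apply/Rf/RB.
pose fM := GRing.isZmodMorphism.Build U V f f_additive.
by exists (HB.pack f fM : {additive U -> V}).
Qed.

Section CohomologyClasses.
Variable G : mgraph.

Lemma cocycle_diff i (z : cocycle G i) : diff (cocycle_val z) = 0.
Proof. by apply/eqP; have := cocycleP z; rewrite inE. Qed.

Lemma cocycle_of i (x : cochain G i) :
  diff x = 0 -> exists z : cocycle G i, cocycle_val z = x.
Proof. by move=> /eqP x0; exists (@Cocycle G i x x0). Qed.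

(** The counterpart of [is_coboundary] on bare cochains, which keeps cocycle proofs out of the
    diagram chases. *)
Definition coboundary i : cochain G i -> Prop :=
  match i return cochain G i -> Prop with
  | 0%N => fun x => x = 0
  | i'.+1 => fun x => exists y, diff y = x
  end.

Lemma coh_class_eq i (z w : cocycle G i) :
  coh_class z = coh_class w <-> coboundary (cocycle_val z - cocycle_val w).
Proof.
have -> : coh_class z = coh_class w <-> z - w \in is_coboundary (i := i).
  by rewrite Quotient.idealrBE; split=> [/eqP // | /eqP].
case: i z w => [|i] z w; rewrite inE.
  split=> [/eqP zw | zw]; last exact/eqP/val_inj.
  exact (congr1 (@cocycle_val G 0) zw).
by split=> /asboolP.
Qed.

Lemma coh_class0 i (z : cocycle G i) :
  coh_class z = 0 <-> coboundary (cocycle_val z).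
Proof.
by rewrite -[0](raddf0 (\pi_(cohomology G i))%qT) coh_class_eq subr0.
Qed.

Lemma coh_class_0 i : coh_class (0 : cocycle G i) = 0.
Proof. exact: raddf0. Qed.

Lemma coh_classB i (z w : cocycle G i) :
  coh_class (z - w) = coh_class z - coh_class w.
Proof. exact: raddfB. Qed.

Lemma coh_classP i (c : cohomology G i) : exists z, c = coh_class z.
Proof. by exists (repr c); rewrite /coh_class reprK. Qed.

End CohomologyClasses.

(** The two degrees are independent, so that this covers both [beta] and the degree-raising
    [alpha]. *)
Lemma induced_map (A B : mgraph) i j (f : {additive cochain A i -> cochain B j}) :
    (forall x, diff x = 0 -> diff (f x) = 0) ->
    (forall x, coboundary x -> coboundary (f x)) ->
  exists fS : {additive cohomology A i -> cohomology B j},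
    forall (z : cocycle A i) (w : cocycle B j),
      cocycle_val w = f (cocycle_val z) -> fS (coh_class z) = coh_class w.
Proof.
move=> f_diff f_cob; pose R a b := exists (z : cocycle A i) (w : cocycle B j),
  [/\ coh_class z = a, coh_class w = b & cocycle_val w = f (cocycle_val z)].
have [a | _ _ _ _ [z [w [<- <- zw]]] [z' [w' [<- <- zw']]]
     | _ [z [w [z0 <- wE]]] | g gP] := @additive_of_rel _ _ R.
- have [z ->] := coh_classP a.
  have /f_diff/cocycle_of[w wE] := cocycle_diff z.
  by exists (coh_class w), z, w.
- exists (z - z'), (w - w'); split; rewrite ?coh_classB //.
  by rewrite raddfB /= -zw -zw'.
- by apply/coh_class0; rewrite wE; apply/f_cob/coh_class0.
by exists g => z w zw; apply/gP; exists z, w.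
Qed.

Lemma choice_dep (I : Type) (T : I -> Type) (P : forall i, T i -> Prop) :
  (forall i, exists x, P i x) -> exists f : forall i, T i, forall i, P i (f i).
Proof.
by move=> h; exists (fun i => sval (cid (h i))) => i; apply: svalP (cid (h i)).
Qed.

(** * The zigzag lemma *)

Section LongExact.
Variables K G L : mgraph.
Variable alpha : forall i, {additive cochain K i -> cochain G i.+1}.
Variable beta : forall i, {additive cochain G i -> cochain L i}.
Hypothesis alpha_diff : forall i x, diff (alpha i x) = alpha i.+1 (diff x).
Hypothesis beta_diff : forall i x, diff (beta i x) = beta i.+1 (diff x).
Hypothesis alpha_inj : forall i, injective (alpha i).
Hypothesis beta0_inj : injective (beta 0%N).
Hypothesis alpha_beta : forall i, exact_at (alpha i) (beta i.+1).
Hypothesis beta_surj : forall i x, exists y, beta i y = x.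

Lemma alpha_eq0 i x : alpha i x = 0 -> x = 0.
Proof. by move=> x0; apply: alpha_inj; rewrite x0 raddf0. Qed.

Lemma beta0_eq0 x : beta 0%N x = 0 -> x = 0.
Proof. by move=> x0; apply: beta0_inj; rewrite x0 raddf0. Qed.

Lemma beta_alpha i x : beta i.+1 (alpha i x) = 0.
Proof. by apply/alpha_beta; exists x. Qed.

Lemma beta_cocycle i x : diff x = 0 -> diff (beta i x) = 0.
Proof. by rewrite beta_diff => ->; rewrite raddf0. Qed.

Lemma alpha_cocycle i x : diff x = 0 -> diff (alpha i x) = 0.
Proof. by rewrite alpha_diff => ->; rewrite raddf0. Qed.

Lemma beta_coboundary i x : coboundary x -> coboundary (beta i x).
Proof.
case: i x => [|i] x /= => [-> | [y <-]]; first exact: raddf0.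
by exists (beta i y); rewrite beta_diff.
Qed.

Lemma alpha_coboundary i x : coboundary x -> coboundary (alpha i x).
Proof.
case: i x => [|i] x /= => [-> | [y <-]]; first by exists 0; rewrite !raddf0.
by exists (alpha i y); rewrite alpha_diff.
Qed.

(** Lift [z] to [x]. As [z] is a cocycle, [beta] kills [diff x], which therefore comes from the
    first complex, and injectivity of [alpha] makes its preimage a cocycle. *)
Lemma connecting_lift i (z : cocycle L i) :
  exists (x : cochain G i) (w : cocycle K i),
    beta i x = cocycle_val z /\ diff x = alpha i (cocycle_val w).
Proof.
have [x xz] := beta_surj (cocycle_val z).
have /alpha_beta[u uE] : beta i.+1 (diff x) = 0.
  by rewrite -beta_diff xz cocycle_diff.
have /cocycle_of[w wE] : diff u = 0.
  by apply: alpha_eq0; rewrite -alpha_diff uE diff_diff.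
by exists x, w; rewrite wE uE.
Qed.

(** Independence of the choices in the connecting map. In positive degree, correct [x] by the
    differential of a lift of [y]; the difference comes from some [u] with [diff u = w]. In degree
    0, [beta] is injective, so [x] and [w] vanish. *)
Lemma connecting_coboundary i (x : cochain G i) (w : cochain K i) :
  coboundary (beta i x) -> diff x = alpha i w -> coboundary w.
Proof.
case: i x w => [|i] x w /=.
  by move=> /beta0_eq0 ->; rewrite raddf0 => /esym/alpha_eq0.
move=> [y yE] dx; have [y' y'E] := beta_surj y.
have /alpha_beta[u uE] : beta i.+1 (x - diff y') = 0.
  by rewrite raddfB /= -beta_diff y'E yE subrr.
exists u; apply: alpha_inj.
by rewrite -dx -alpha_diff uE raddfB /= diff_diff subr0.
Qed.

Lemma connecting_map i :
  exists gammaS : {additive cohomology L i -> cohomology K i},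
  forall (z : cocycle L i) (x : cochain G i) (w : cocycle K i),
    beta i x = cocycle_val z -> diff x = alpha i (cocycle_val w) ->
    gammaS (coh_class z) = coh_class w.
Proof.
pose R a b := exists (z : cocycle L i) (x : cochain G i) (w : cocycle K i),
  [/\ coh_class z = a, coh_class w = b, beta i x = cocycle_val z
    & diff x = alpha i (cocycle_val w)].
have [a | | _ [z [x [w [z0 <- xz xw]]]] | f fP] := @additive_of_rel _ _ R.
- have [z ->] := coh_classP a; have [x [w [xz xw]]] := connecting_lift z.
  by exists (coh_class w), z, x, w.
- move=> _ _ _ _ [z [x [w [<- <- xz xw]]]] [z' [x' [w' [<- <- xz' xw']]]].
  exists (z - z'), (x - x'), (w - w'); split; rewrite ?coh_classB //.
    by rewrite raddfB /= xz xz'.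
  by rewrite raddfB /= xw xw' -raddfB.
- apply/coh_class0/(connecting_coboundary _ xw); rewrite xz.
  exact/coh_class0.
by exists f => z x w xz xw; apply/fP; exists z, x, w.
Qed.

Lemma long_exact_sequence :
  exists (betaS : forall i, {additive cohomology G i -> cohomology L i})
         (gammaS : forall i, {additive cohomology L i -> cohomology K i})
         (alphaS : forall i, {additive cohomology K i -> cohomology G i.+1}),
  [/\ forall i (z : cocycle G i) (w : cocycle L i),
        cocycle_val w = beta i (cocycle_val z) ->
        betaS i (coh_class z) = coh_class w,
      forall i (z : cocycle K i) (w : cocycle G i.+1),
        cocycle_val w = alpha i (cocycle_val z) ->
        alphaS i (coh_class z) = coh_class w,
      forall i (z : cocycle L i) (x : cochain G i) (w : cocycle K i),
        beta i x = cocycle_val z ->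
        diff x = alpha i (cocycle_val w) ->
        gammaS i (coh_class z) = coh_class w
    & [/\ injective (betaS 0%N),
          forall i, exact_at (betaS i) (gammaS i),
          forall i, exact_at (gammaS i) (alphaS i)
        & forall i, exact_at (alphaS i) (betaS i.+1)]].
Proof.
have /choice_dep[betaS bP] := fun i => induced_map (@beta_cocycle i) (@beta_coboundary i).
have /choice_dep[alphaS aP] := fun i => induced_map (@alpha_cocycle i) (@alpha_coboundary i).
have /choice_dep[gammaS gP] := connecting_map.
exists betaS, gammaS, alphaS; split=> //; split.
- apply/raddf_inj => a; have [z ->] := coh_classP a.
  have [w wE] := cocycle_of (beta_cocycle (cocycle_diff z)).
  rewrite (bP _ _ _ wE) => /coh_class0 /=; rewrite wE => z0.
  exact/coh_class0/beta0_eq0.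
(* Exactness at the third complex: if the connecting class is 0, then [w] is [diff y] and
   [x - alpha y] is a cocycle lifting [z]; in degree 0, [w = 0] and [x] itself is one. Conversely a
   cocycle lift has differential 0. *)
- move=> i v; split=> [| [u <-]].
    have [z ->] := coh_classP v; have [x [w [xz xw]]] := connecting_lift z.
    rewrite (gP _ _ _ _ xz xw) => /coh_class0 w0.
    suff [y dy yz] : exists2 y, diff y = 0 & beta i y = cocycle_val z.
      have [u uE] := cocycle_of dy; exists (coh_class u).
      by apply: bP; rewrite uE yz.
    case: i z x w {v} xz xw w0 => [|i] z x w xz xw /= w0.
      by exists x; rewrite // xw w0 raddf0.
    have [y yw] := w0; exists (x - alpha i y).
      by rewrite raddfB /= alpha_diff yw xw subrr.
    by rewrite raddfB /= beta_alpha subr0.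
  have [z ->] := coh_classP u; have [w wE] := cocycle_of (beta_cocycle (cocycle_diff z)).
  rewrite (bP _ _ _ wE) (gP _ _ (cocycle_val z) 0) ?coh_class_0 //.
  by rewrite cocycle_diff; apply/esym/(raddf0 (alpha i)).
(* Exactness at the first complex: if [alpha w = diff x], then [beta x] is a cocycle whose
   connecting class is that of [w]. *)
- move=> i v; split=> [| [u <-]].
    have [w ->] := coh_classP v; have [z zE] := cocycle_of (alpha_cocycle (cocycle_diff w)).
    rewrite (aP _ _ _ zE) => /coh_class0 /=; rewrite zE => -[x xw].
    have [y yE] : exists y : cocycle L i, cocycle_val y = beta i x.
      by apply: cocycle_of; rewrite beta_diff xw beta_alpha.
    by exists (coh_class y); apply: gP xw.
  have [z ->] := coh_classP u; have [x [w [xz xw]]] := connecting_lift z.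
  rewrite (gP _ _ _ _ xz xw); have [y yE] := cocycle_of (alpha_cocycle (cocycle_diff w)).
  by rewrite (aP _ _ _ yE); apply/coh_class0; exists x; rewrite yE.
(* Exactness at the middle complex: if [beta z] is [diff y], subtracting from [z] the differential
   of a lift of [y] leaves the image of a cocycle under [alpha]. *)
move=> i v; split=> [| [u <-]].
  have [z ->] := coh_classP v; have [w wE] := cocycle_of (beta_cocycle (cocycle_diff z)).
  rewrite (bP _ _ _ wE) => /coh_class0 /=; rewrite wE => -[y yz].
  have [y' y'y] := beta_surj y.
  have /alpha_beta[x xE] : beta i.+1 (cocycle_val z - diff y') = 0.
    by rewrite raddfB /= -beta_diff y'y yz subrr.
  have /cocycle_of[t tE] : diff x = 0.
    by apply: alpha_eq0; rewrite -alpha_diff xE raddfB /= cocycle_diff diff_diff subrr.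
  have [r rE] := cocycle_of (alpha_cocycle (cocycle_diff t)).
  exists (coh_class t); rewrite (aP _ _ _ rE); apply/coh_class_eq.
  by exists (- y'); rewrite rE tE xE raddfN addrAC subrr add0r.
have [z ->] := coh_classP u; have [w wE] := cocycle_of (alpha_cocycle (cocycle_diff z)).
rewrite (aP _ _ _ wE) (bP _ _ 0) ?coh_class_0 //.
by rewrite wE beta_alpha.
Qed.

End LongExact.

(** * The maps alpha and beta between the chromatic complexes *)

Section ChainMaps.
Variables (G : mgraph) (e : 'I_(nlab G)).
Hypotheses (eG : e \in edges G) (e_nloop : ~~ is_loop e).
Notation H := (contract e).
Notation D := (delete e).

Definition lift_sign i (w : state H i) : int := contr_sign e (edges_of w).

Definition alpha_fun i : cochain H i -> cochain G i.+1 :=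
  push (@lift_state G e eG i) (@lift_sign i).

Definition beta_fun i : cochain G i -> cochain D i := pull (@emb_state G e i).

HB.instance Definition _ i := GRing.isZmodMorphism.Build
  (cochain H i) (cochain G i.+1) (@alpha_fun i) (@push_is_zmod_morphism _ _ _ _).
HB.instance Definition _ i := GRing.isZmodMorphism.Build
  (cochain G i) (cochain D i) (@beta_fun i) (@pull_is_zmod_morphism _ _ _).

Lemma lift_sign2 i (w : state H i) : lift_sign w * lift_sign w = 1.
Proof. by rewrite /lift_sign /contr_sign -expr2 sqrr_sign. Qed.

Lemma alpha_fun_diff i (x : cochain H i) :
  diff (alpha_fun x) = alpha_fun (diff x).
Proof.
apply: (push_commute (@diffE H i) (@diffE G i.+1)).
- exact: lift_state_inj.
- exact: lift_state_inj.
- exact: diff_coef_lift.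
- exact: diff_coef_lift_out.
Qed.

Lemma beta_fun_diff i (x : cochain G i) : diff (beta_fun x) = beta_fun (diff x).
Proof.
apply/esym/(pull_commute (@diffE D i) (@diffE G i)).
- exact: emb_state_inj.
- exact: diff_coef_emb.
- exact: diff_coef_emb_out.
Qed.

(** Every monomial in the image comes from one in [x] by [uncontract], which preserves both sums of
    exponents. *)
Lemma alpha_fun_homogeneous i p q (x : cochain H i) :
  homogeneous p q x -> homogeneous p q (alpha_fun x).
Proof.
move=> xpq t xt.
have [w wt xw] := push_supp (@lift_state_inj _ _ eG e_nloop i) xt.
have [w1 w2] := xpq w xw; rewrite -wt; split.
  exact (etrans (sum_uncontract_x (exps w)) w1).
exact (etrans (sum_uncontract_y e_nloop (exps w) (notin_edges_of w)) w2).
Qed.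

Lemma beta_fun_homogeneous i p q (x : cochain G i) :
  homogeneous p q x -> homogeneous p q (beta_fun x).
Proof.
move=> xpq u; have -> : beta_fun x u = x (emb_state u) by exact: ffunE.
exact (xpq (emb_state u)).
Qed.

(** Compare coefficients at each state [t]: both vanish if [t] avoids [e]; otherwise [t] is a lift
    and the sum is reindexed along [uncontract]. *)
Lemma alpha_fun_incl i (s : {set 'I_(nlab G)}) (y : Csub (G := H) s) :
    e \notin s ->
  alpha_fun (incl i y) = incl i.+1 (contr_id y) *~ contr_sign e s.
Proof.
move=> es; apply/ffunP=> t; apply/esym; apply: etrans (cochainMzE _ _ _) _.
have inclE (v : Csub (e |: s)) :
  incl i.+1 v t = \sum_(v' | val t == Tagged (@basis G) v') v v' by exact: ffunE.
rewrite inclE {inclE}.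
have [et | et] := boolP (e \in edges_of t); last first.
  rewrite [RHS]push_out; last by apply/lift_state_out/emb_stateP.
  rewrite big1 ?mul0rz // => v /eqP tv.
  by case/negP: et; rewrite /edges_of tv setU11.
have /lift_stateP-/(_ eG e_nloop)[w wt] := et.
rewrite -wt [RHS](pushE (@lift_sign i) (@lift_state_inj _ _ eG e_nloop i)).
have -> : incl i y w = \sum_(v | val w == Tagged (@basis H) v) y v by exact: ffunE.
rewrite (reindex (@uncontract G e s)); last exact/onW_bij/uncontract_bij.
rewrite mulrz_suml mulr_suml.
have eqE (v : basis (G := H) s) :
  (val (lift_state eG w) == Tagged (@basis G) (uncontract v))
    = (val w == Tagged (@basis H) v).
  apply/eqP/eqP => [/(Tagged_uncontract_inj e_nloop (notin_edges_of w) es) <- | wv].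
    by rewrite /exps /edges_of; case: (val w).
  by rewrite /= /exps /edges_of wv.
apply: eq_big => [v | v wv]; first exact: eqE.
rewrite eqE in wv; rewrite contr_id_uncontract // mulrzz.
by rewrite /lift_sign /edges_of (eqP wv).
Qed.

Lemma beta_fun_incl i (s : {set 'I_(nlab G)}) (y : Csub s) :
  beta_fun (incl i y) = if e \in s then 0 else @incl D i s y.
Proof.
apply/ffunP=> u.
have -> : beta_fun (incl i y) u = incl i y (emb_state u) by exact: ffunE.
have -> : incl i y (emb_state u) = \sum_(v | val u == Tagged (@basis G) v) y v.
  exact: ffunE.
(* For [e \notin s] the two inclusions have the same coefficients by conversion; for [e \in s] no
   state of the deletion has edge set [s]. *)
case: ifP => es; last by apply/esym; exact: ffunE.
rewrite ffunE big1 // => v /eqP uv; have := edges_ofP u.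
by rewrite /edges_of uv => -[/subsetD1P[_ /negP]].
Qed.

Lemma alpha_fun_inj i : injective (@alpha_fun i).
Proof. exact: push_inj (@lift_state_inj _ _ eG e_nloop i) (@lift_sign2 i). Qed.

Lemma alpha_beta_exact i : exact_at (@alpha_fun i) (@beta_fun i.+1).
Proof.
move=> y; apply: push_pull_exact (@lift_sign2 i) y.
- exact: lift_state_inj.
- exact: lift_state_out.
Qed.

Lemma beta_fun_surj i x : exists y, @beta_fun i y = x.
Proof. exact: pull_surj (@emb_state_inj _ _ i) x. Qed.

(** In degree 0 the only edge set is empty, hence avoids [e], and every state of [G] is one of the
    deletion. *)
Lemma beta_fun0_inj : injective (@beta_fun 0).
Proof.
move=> x y /ffunP xy; apply/ffunP=> t.
have /emb_stateP[u ut] : e \notin edges_of t.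
  by have [_ /cards0_eq->] := edges_ofP t; rewrite inE.
rewrite -ut; have := xy u.
have bE (z : cochain G 0) : beta_fun z u = z (emb_state u) by exact: ffunE.
by rewrite !bE.
Qed.

End ChainMaps.

Theorem theorem5p2 (G : mgraph) (e : 'I_(nlab G))
    (eG : e \in edges G) (e_nloop : ~~ is_loop e) :
  exists (alpha : forall i, {additive cochain (contract e) i -> cochain G i.+1})
         (beta : forall i, {additive cochain G i -> cochain (delete e) i}),
  [/\ (* alpha and beta on the summands *)
      (forall s : {set 'I_(nlab G)}, s \subset edges (contract e) ->
         bijective (@contr_id G e s))
      /\ (forall i (s : {set 'I_(nlab G)}) (y : Csub (G := contract e) s),
         s \subset edges (contract e) -> #|s| = i ->
         alpha i (incl i y) = incl i.+1 (contr_id y) *~ contr_sign e s),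
      (forall i (s : {set 'I_(nlab G)}) (y : Csub (G := G) s),
         s \subset edges G -> #|s| = i ->
         beta i (incl i y) =
           if e \in s then 0 else @incl (delete e) i s y),
      (* chain maps, preserving the bidegree *)
      [/\ forall i x, diff (alpha i x) = alpha i.+1 (diff x),
          forall i x, diff (beta i x) = beta i.+1 (diff x),
          forall i p q x, homogeneous p q x -> homogeneous p q (alpha i x)
        & forall i p q x, homogeneous p q x -> homogeneous p q (beta i x)],
      (* 0 -> C^(i-1)(G/e) -> C^i(G) -> C^i(G-e) -> 0, with C^(-1)(G/e) = 0 *)
      [/\ forall i, injective (alpha i),
          injective (beta 0%N),
          forall i, exact_at (alpha i) (beta i.+1)
        & forall i x, exists y, beta i y = x]
    & (* the long exact sequence; gammaS is the connecting homomorphism *)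
      exists (betaS : forall i,
                {additive cohomology G i -> cohomology (delete e) i})
             (gammaS : forall i,
                {additive cohomology (delete e) i ->
                          cohomology (contract e) i})
             (alphaS : forall i,
                {additive cohomology (contract e) i -> cohomology G i.+1}),
      [/\ forall i (z : cocycle G i) (w : cocycle (delete e) i),
            cocycle_val w = beta i (cocycle_val z) ->
            betaS i (coh_class z) = coh_class w,
          forall i (z : cocycle (contract e) i) (w : cocycle G i.+1),
            cocycle_val w = alpha i (cocycle_val z) ->
            alphaS i (coh_class z) = coh_class w,
          forall i (z : cocycle (delete e) i) (x : cochain G i)
                 (w : cocycle (contract e) i),
            beta i x = cocycle_val z ->
            diff x = alpha i (cocycle_val w) ->
            gammaS i (coh_class z) = coh_class w
        & [/\ injective (betaS 0%N),
              forall i, exact_at (betaS i) (gammaS i),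
              forall i, exact_at (gammaS i) (alphaS i)
            & forall i, exact_at (alphaS i) (betaS i.+1)]]].
Proof.
exists (fun i => @alpha_fun G e eG i), (fun i => @beta_fun G e i); split.
- split=> [s sH | i s y sH _]; first exact/contr_id_bij/(notin_edges_contr sH).
  exact/alpha_fun_incl/(notin_edges_contr sH).
- by move=> i s y _ _; apply: beta_fun_incl.
- split.
  + by move=> i x; apply: alpha_fun_diff.
  + by move=> i x; apply: beta_fun_diff.
  + by move=> i p q x; apply: alpha_fun_homogeneous.
  + by move=> i p q x; apply: beta_fun_homogeneous.
- split.
  + by move=> i; apply: alpha_fun_inj.
  + exact: beta_fun0_inj.
  + by move=> i; apply: alpha_beta_exact.
  + by move=> i x; apply: beta_fun_surj.
apply: long_exact_sequence.
- by move=> i x; apply: alpha_fun_diff.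
- by move=> i x; apply: beta_fun_diff.
- by move=> i; apply: alpha_fun_inj.
- exact: beta_fun0_inj.
- by move=> i; apply: alpha_beta_exact.
- by move=> i x; apply: beta_fun_surj.
Qed.
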